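(* Let $d\ge1$, $\lambda>0$, $\delta>0$, and let $f:\mathbb{R}^d\to\mathbb{R}$ satisfy: (A1) $f$ is continuous and has at least one minimizer; (A2) $\int_{\mathbb{R}^d}\exp(-f(y)/\delta)\,dy<+\infty$. Assume that $f^{\lambda,\delta}$ is convex and let $X^\star_{\lambda,\delta}:=\operatorname{argmin}f^{\lambda,\delta}$. Then there exists a convex function $H_{\lambda,\delta}:\mathbb{R}^d\to\mathbb{R}$ such that $\operatorname{zprox}^\delta_{\lambda,f}=\operatorname{prox}_{\lambda\delta H_{\lambda,\delta}}$; in particular $\operatorname{zprox}^\delta_{\lambda,f}$ is firmly nonexpansive. Moreover, the ZOPPA sequence $(x^k)_{k\in\mathbb{N}}$ converges to some $x^\star_{\lambda,\delta}\in X^\star_{\lambda,\delta}$, and for every $k\ge1$, \[f^{\lambda,\delta}(x^k)-\min f^{\lambda,\delta}\le\frac{\operatorname{dist}(x^0,X^\star_{\lambda,\delta})^2}{2\lambda k},\qquad \|\nabla f^{\lambda,\delta}(x^k)\|\le\frac{2\operatorname{dist}(x^0,X^\star_{\lambda,\delta})}{\lambda(k+1)}.\]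
   Context: The zeroth-order proximal operator is $\operatorname{zprox}^\delta_{\lambda,f}(x)=\dfrac{\mathbb{E}_{y\sim\mathcal N(x,\lambda\delta I)}[y\exp(-f(y)/\delta)]}{\mathbb{E}_{y\sim\mathcal N(x,\lambda\delta I)}[\exp(-f(y)/\delta)]}$; the soft Moreau envelope is $f^{\lambda,\delta}(x)=-\delta\log\mathbb{E}_{y\sim\mathcal N(x,\lambda\delta I)}[\exp(-f(y)/\delta)]$. For $g:\mathbb{R}^d\to\mathbb{R}$ and $t>0$, $\operatorname{prox}_{tg}(x)=\operatorname{argmin}_y\{t g(y)+\frac12\|y-x\|^2\}$. An operator $T$ is firmly nonexpansive if $\|Tx-Ty\|^2\le\langle Tx-Ty,x-y\rangle$ for all $x,y$. ZOPPA: given $x^0\in\mathbb{R}^d$, iterate $x^{k+1}=\operatorname{zprox}^\delta_{\lambda,f}(x^k)$. *)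

(* Defs.v *)
From HB Require Import structures.
From mathcomp Require Import all_boot all_order all_algebra.
From mathcomp Require Import all_classical all_reals all_analysis.
Set Implicit Arguments. Unset Strict Implicit. Unset Printing Implicit Defensive.
Import Order.TTheory GRing.Theory Num.Theory.
Import numFieldNormedType.Exports.
Local Open Scope classical_set_scope.
Local Open Scope ring_scope.

Section Defs.
Variable R : realType.

Definition dotv (d : nat) (x y : 'rV[R]_d) : R := \sum_(i < d) x ord0 i * y ord0 i.
Definition enorm (d : nat) (x : 'rV[R]_d) : R := Num.sqrt (dotv x x).

(* Lebesgue integral over R^d of a nonnegative (extended-real valued)
   function, computed as the iterated one-dimensional Lebesgue integral
   (equal to the integral w.r.t. d-dimensional Lebesgue measure by Tonelli). *)
Fixpoint iint (d : nat) : ('rV[R]_d -> \bar R) -> \bar R :=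
  match d return ('rV[R]_d -> \bar R) -> \bar R with
  | 0 => fun g => g 0
  | d'.+1 => fun g =>
      (\int[@lebesgue_measure R]_(t in [set: R])
         iint (fun v : 'rV[R]_d' =>
           g (\row_(i < d'.+1) (if unlift ord0 i is Some j then v ord0 j else t))))%E
  end.

Definition Rint (d : nat) (g : 'rV[R]_d -> R) : R :=
  fine (iint (fun y => (Num.max (g y) 0)%:E)) -
  fine (iint (fun y => (Num.max (- g y) 0)%:E)).

Definition gauss_dens (d : nat) (s : R) (x y : 'rV[R]_d) : R :=
  (Num.sqrt (2 * pi * s)) ^- d * expR (- (enorm (y - x)) ^+ 2 / (2 * s)).

Definition gexp (d : nat) (s : R) (x : 'rV[R]_d) (h : 'rV[R]_d -> R) : R :=
  Rint (fun y => gauss_dens s x y * h y).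

Definition zprox (d : nat) (lam del : R) (f : 'rV[R]_d -> R) (x : 'rV[R]_d)
  : 'rV[R]_d :=
  \row_(i < d) (gexp (lam * del) x (fun y => y ord0 i * expR (- f y / del)) /
                gexp (lam * del) x (fun y => expR (- f y / del))).

Definition soft_env (d : nat) (lam del : R) (f : 'rV[R]_d -> R) (x : 'rV[R]_d) : R :=
  - del * ln (gexp (lam * del) x (fun y => expR (- f y / del))).

Definition prox_set (d : nat) (t : R) (g : 'rV[R]_d -> R) (x : 'rV[R]_d)
  : set 'rV[R]_d :=
  [set p | forall y, t * g p + (enorm (p - x)) ^+ 2 / 2 <= t * g y + (enorm (y - x)) ^+ 2 / 2].

Definition argmin_set (d : nat) (F : 'rV[R]_d -> R) : set 'rV[R]_d :=
  [set z | forall y, F z <= F y].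

Definition convex_fn (d : nat) (F : 'rV[R]_d -> R) : Prop :=
  forall (x y : 'rV[R]_d) (t : R), 0 <= t -> t <= 1 ->
    F (t *: x + (1 - t) *: y) <= t * F x + (1 - t) * F y.

Definition firmly_nonexpansive (d : nat) (T : 'rV[R]_d -> 'rV[R]_d) : Prop :=
  forall x y, (enorm (T x - T y)) ^+ 2 <= dotv (T x - T y) (x - y).

Definition dist_set (d : nat) (x : 'rV[R]_d) (A : set 'rV[R]_d) : R :=
  inf [set enorm (x - z) | z in A].

Definition grad (d : nat) (F : 'rV[R]_d -> R) (x : 'rV[R]_d) : 'rV[R]_d :=
  \row_(i < d) ('d F x (delta_mx ord0 i : 'rV[R]_d)).

End Defs.

(* Main.v *)
Require Import Defs.
From HB Require Import structures.
From mathcomp Require Import all_boot all_order all_algebra.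
From mathcomp Require Import all_classical all_reals all_analysis.
From mathcomp Require Import measurable_realfun ring lra zify.
Import Order.TTheory GRing.Theory Num.Theory.
Import numFieldNormedType.Exports.
Local Open Scope classical_set_scope.
Local Open Scope ring_scope.

(* Write [s = lam * del], [psi = lam * f^{lam,del}], [p = zprox], and let [G x] be the Gaussian mean of [exp (- f / del)]. Since [psi = - s ln G] and [p x] is the mean of the tilted Gaussian at [x], the inequality [exp u >= 1 + u] gives [psi (x + h) <= psi x + <x - p x, h> + |h|^2 / 2]. Together with the convexity of [psi], this upper bound alone forces [psi] to be differentiable with gradient [x - p x], without differentiating under the integral, and [p] to be a gradient step on [psi]. Setting [S q = sup_z (psi z - |z - q|^2 / 2)], one gets [p = prox_S]; [S] is convex because [z = q + u] makes it a supremum of translates of [psi], and it is finite because the measure charges a unit cube in the orthant of [z - q] at [q]. Minimizers exist since [G] vanishes at infinity by dominated convergence. The rates and the convergence are those of gradient descent on a 1-smooth convex function. *)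

(** * Euclidean structure of row vectors *)

Section Euclidean.
Context {R : realType} {d : nat}.
Implicit Types (x y z : 'rV[R]_d) (a : R).

Lemma dotvC x y : dotv x y = dotv y x.
Proof. by apply: eq_bigr => i _; rewrite mulrC. Qed.

Lemma dotvDr x y z : dotv x (y + z) = dotv x y + dotv x z.
Proof. by rewrite -big_split; apply: eq_bigr => i _; rewrite mxE mulrDr. Qed.

Lemma dotvZr a x y : dotv x (a *: y) = a * dotv x y.
Proof. by rewrite mulr_sumr; apply: eq_bigr => i _; rewrite mxE mulrCA. Qed.

Lemma dotvDl x y z : dotv (y + z) x = dotv y x + dotv z x.
Proof. by rewrite dotvC dotvDr !(dotvC x). Qed.

Lemma dotvZl a x y : dotv (a *: y) x = a * dotv y x.
Proof. by rewrite dotvC dotvZr (dotvC x). Qed.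

Lemma dotvNr x y : dotv x (- y) = - dotv x y.
Proof. by rewrite -scaleN1r dotvZr mulN1r. Qed.

Lemma dotvNl x y : dotv (- y) x = - dotv y x.
Proof. by rewrite dotvC dotvNr (dotvC x). Qed.

Definition dotvE := (dotvDr, dotvDl, dotvZr, dotvZl, dotvNr, dotvNl).

Fact dotv_is_linear x : linear (dotv x).
Proof. by move=> a y z; rewrite dotvDr dotvZr. Qed.

HB.instance Definition _ x :=
  GRing.isLinear.Build R 'rV[R]_d R _ (dotv x) (dotv_is_linear x).

Lemma dotv_ge0 x : 0 <= dotv x x.
Proof. by apply: sumr_ge0 => i _; rewrite -expr2 sqr_ge0. Qed.

Lemma sqr_enorm x : enorm x ^+ 2 = dotv x x.
Proof. by rewrite sqr_sqrtr// dotv_ge0. Qed.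

Lemma enorm_ge0 x : 0 <= enorm x.
Proof. exact: sqrtr_ge0. Qed.

Lemma coord_le_enorm x i : `|x ord0 i| <= enorm x.
Proof.
rewrite -sqrtr_sqr ler_sqrt ?dotv_ge0// /dotv (bigD1 i)//= -expr2 lerDl.
by apply: sumr_ge0 => j _; rewrite -expr2 sqr_ge0.
Qed.

(** The norm on ['rV[R]_d] is the maximum of the coordinates; with [dotv_le_norm], this passes
    between it and the Euclidean norm. *)
Lemma norm_le_enorm x : `|x| <= enorm x.
Proof.
rewrite [leLHS]/Num.norm/= mx_normrE; apply/bigmax_leP; split=> [|[i j] _] /=.
  exact: enorm_ge0.
by rewrite ord1; exact: coord_le_enorm.
Qed.

Lemma coord_le_norm x i : `|x ord0 i| <= `|x|.
Proof.
by rewrite [leRHS]/Num.norm/= mx_normrE; apply/bigmax_geP; right; exists (ord0, i).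
Qed.

Lemma dotv_le_norm x : dotv x x <= d%:R * `|x| ^+ 2.
Proof.
rewrite mulr_natl -[X in _ *+ X]card_ord -sumr_const; apply: ler_sum => i _.
by rewrite -expr2 -real_normK ?num_real// lerXn2r ?nnegrE ?coord_le_norm.
Qed.

Lemma dotv_eq0 x : dotv x x = 0 -> x = 0.
Proof.
move=> x0; apply/normr0_eq0/eqP; rewrite eq_le normr_ge0 andbT.
by rewrite (le_trans (norm_le_enorm x))// /enorm x0 sqrtr0.
Qed.

Lemma dotv_continuous x : continuous (dotv x).
Proof.
suff H (s : seq 'I_d) y : \sum_(i <- s) x ord0 i * z ord0 i @[z --> y]
    --> \sum_(i <- s) x ord0 i * y ord0 i by move=> y; exact: H.
elim: s => [|i s ih].
  by under eq_fun do rewrite big_nil; rewrite big_nil; exact: cvg_cst.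
under eq_fun do rewrite big_cons; rewrite big_cons.
apply: cvgD ih; apply: cvgM; [exact: cvg_cst|exact: coord_continuous].
Qed.

Lemma nbhs_dotv x e : 0 < e -> nbhs x [set v | dotv (v - x) (v - x) < e].
Proof.
(* [d.+1] rather than [d], so that the radius is positive in dimension 0 as well. *)
move=> e0; have D0 : 0 < e / d.+1%:R by rewrite divr_gt0.
apply/nbhs_ballP; exists (Num.sqrt (e / d.+1%:R)) => /= [|v].
  by rewrite sqrtr_gt0.
rewrite mx_norm_ball /ball_/= distrC -[X in X < _]ger0_norm// -sqrtr_sqr ltr_sqrt//.
rewrite ltr_pdivlMr// mulrC; apply: le_lt_trans.
by rewrite (le_trans (dotv_le_norm _))// ler_wpM2r ?sqr_ge0// ler_nat.
Qed.

Lemma dotv_delta x i : dotv x (delta_mx ord0 i) = x ord0 i.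
Proof.
rewrite /dotv (bigD1 i)//= mxE !eqxx mulr1 big1 ?addr0// => j ji.
by rewrite mxE eqxx (negbTE ji) mulr0.
Qed.

(** The rates are proved for each minimizer separately and pass to the distance here. The set must
    be nonempty because [inf] of the empty set is 0 by default. *)
Lemma le_dist_set x0 (A : set 'rV[R]_d) (c : R) : A !=set0 ->
  (forall z, A z -> c <= enorm (x0 - z)) -> c <= dist_set x0 A.
Proof.
move=> [z Az] cA; apply: lb_le_inf; first by exists (enorm (x0 - z)), z.
by move=> _ [w Aw <-]; exact: cA.
Qed.

Lemma le_sqr_dist_set x0 (A : set 'rV[R]_d) (c : R) : A !=set0 ->
  (forall z, A z -> c <= dotv (x0 - z) (x0 - z)) -> c <= dist_set x0 A ^+ 2.
Proof.
move=> A0 cA; have D0 : 0 <= dist_set x0 A.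
  by apply: le_dist_set => // z _; exact: enorm_ge0.
have [c0|/ltW c0] := leP 0 c; last by rewrite (le_trans c0)// sqr_ge0.
rewrite -[c]sqr_sqrtr// lerXn2r ?nnegrE// ?sqrtr_ge0//.
by apply: le_dist_set => // z /cA cz; rewrite ler_sqrt ?dotv_ge0.
Qed.

End Euclidean.

(** * Convex functions with a quadratic upper bound *)

Section GradientInequality.
Context {R : realType} {d : nat} {psi : 'rV[R]_d -> R} {p : 'rV[R]_d -> 'rV[R]_d}.
Hypothesis psi_cvx : convex_fn psi.
Hypothesis psi_up : forall x h,
  psi (x + h) <= psi x + dotv (x - p x) h + dotv h h / 2.

(** Midpoint convexity between [x + h] and [x - h], with the upper bound applied at [x - h]. *)
Lemma psi_quadratic_lower_bound x h : psi x + dotv (x - p x) h - dotv h h / 2 <= psi (x + h).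
Proof.
have := psi_cvx (x + h) (x - h) (2^-1) ltac:(lra) ltac:(lra).
have -> : 2^-1 *: (x + h) + (1 - 2^-1) *: (x - h) = x.
  apply/rowP => i; rewrite !mxE; lra.
have := psi_up x (- h); rewrite !dotvE; lra.
Qed.

(** If the excess [a] were negative, convexity would put the excess at [x + t *: h] below [t * a],
    while the quadratic lower bound keeps it above [- t ^+ 2 * dotv h h / 2]: a conflict for small
    [t]. *)
Lemma gradient_inequality x h : psi x + dotv (x - p x) h <= psi (x + h).
Proof.
rewrite leNgt; apply/negP => lt_psi.
set a := psi (x + h) - (psi x + dotv (x - p x) h).
have a0 : a < 0 by rewrite /a; lra.
have b0 := dotv_ge0 h.
have D0 : 0 < dotv h h + 1 - a by lra.
(* Chosen so that [t <= 1] and [t * dotv h h < - 2 * a]. *)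
pose t := - a / (dotv h h + 1 - a).
have tD : t * (dotv h h + 1 - a) = - a by rewrite /t divfK// gt_eqF.
have t0 : 0 < t by rewrite divr_gt0//; lra.
have t1 : t <= 1 by rewrite ler_pdivrMr//; lra.
have := psi_cvx (x + h) x t (ltW t0) t1.
have -> : t *: (x + h) + (1 - t) *: x = x + t *: h.
  by apply/rowP => i; rewrite !mxE; ring.
have := psi_quadratic_lower_bound x (t *: h).
rewrite !(dotvZl, dotvZr).
have -> : psi (x + h) = a + (psi x + dotv (x - p x) h) by rewrite /a; ring.
clearbody a t; nra.
Qed.

(** The two quadratic bounds confine the first-order remainder to [dotv h h / 2], which is o(h). *)
Lemma is_diff_psi x : is_diff x psi (dotv (x - p x)).
Proof.
have E : psi \o shift x = cst (psi x) + dotv (x - p x) +o_ (0 : 'rV[R]_d) id.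
  apply/eqaddoP => _/posnumP[e]; near=> h.
  rewrite /= !fctE /= (addrC h x).
  apply: (@le_trans _ _ (dotv h h / 2)).
    have := psi_up x h; have := psi_quadratic_lower_bound x h; rewrite ler_norml; lra.
  apply: (@le_trans _ _ ((d%:R * `|h|) * `|h|)).
    have := dotv_le_norm h; have := dotv_ge0 h; rewrite expr2; lra.
  apply: ler_wpM2r => //.
  apply: (@le_trans _ _ (d.+1%:R * `|h|)); first by rewrite ler_wpM2r// ler_nat.
  by rewrite -ler_pdivlMl// mulrC ltW.
have dE := @diff_unique _ _ _ psi (dotv (x - p x)) x (dotv_continuous _) E.
by apply: DiffDef => //; apply/diff_locallyP; rewrite dE; split => //; exact: dotv_continuous.
Unshelve. all: by end_near. Qed.

End GradientInequality.

(** * Gradient steps as proximal maps *)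

Section ProximalMap.
Context {R : realType} {d : nat} {psi : 'rV[R]_d -> R} {p : 'rV[R]_d -> 'rV[R]_d}.
Hypothesis psi_cvx : convex_fn psi.
Hypothesis psi_up : forall x h,
  psi (x + h) <= psi x + dotv (x - p x) h + dotv h h / 2.

Lemma convex_smooth_continuous : continuous psi.
Proof.
move=> x; have ? := is_diff_psi psi_cvx psi_up x.
exact: differentiable_continuous.
Qed.

Let g x := x - p x.

(** At the point [z - (g z - g x)], the gradient inequality at [x] bounds [psi] from below and the
    quadratic upper bound at [z] bounds it from above. *)
Lemma gradient_inequality_strong x z :
  psi x + dotv (g x) (z - x) + dotv (g z - g x) (g z - g x) / 2 <= psi z.
Proof.
have := psi_up z (- (g z - g x)); rewrite -/(g z).
have := gradient_inequality psi_cvx psi_up x (z - (g z - g x) - x); rewrite -/(g x).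
rewrite (addrC x) subrK; move: (g x) (g z) => a b.
rewrite !dotvE (dotvC b a); lra.
Qed.

(** The Baillon-Haddad inequality: the strong inequality is added to itself with [x] and [z]
    exchanged. *)
Lemma grad_cocoercive x z :
  dotv (g z - g x) (g z - g x) <= dotv (g z - g x) (z - x).
Proof.
have := gradient_inequality_strong x z; have := gradient_inequality_strong z x.
move: (g x) (g z) => a b; rewrite !dotvE (dotvC b a); lra.
Qed.

(** Cocoercivity says that [g] is firmly nonexpansive, a property shared by a map and its complement
    to the identity. *)
Lemma prox_firmly_nonexpansive : firmly_nonexpansive p.
Proof.
move=> x y; rewrite sqr_enorm; have := grad_cocoercive y x; rewrite /g.
move: (p x) (p y) => a b.
rewrite !dotvE (dotvC y x) (dotvC a x) (dotvC b x) (dotvC a y) (dotvC b y) (dotvC b a); lra.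
Qed.

Hypothesis psi_quad : forall q, exists B, forall z,
  psi z - dotv (z - q) (z - q) / 2 <= B.

(** Minus the Moreau envelope of [- psi]; equivalently, [S q + dotv q q / 2] is the convex conjugate
    of [dotv z z / 2 - psi z]. [psi_quad] makes this [sup] a genuine one. *)
Let S q := sup [set psi z - dotv (z - q) (z - q) / 2 | z in [set: 'rV[R]_d]].

Let S_ub q z : psi z - dotv (z - q) (z - q) / 2 <= S q.
Proof.
apply: ub_le_sup; last by exists z.
by have [B hB] := psi_quad q; exists B => _ [w _ <-].
Qed.

Let S_lub q B : (forall z, psi z - dotv (z - q) (z - q) / 2 <= B) -> S q <= B.
Proof.
move=> hB; apply: ge_sup; last by move=> _ [w _ <-].
by exists (psi 0 - dotv (0 - q) (0 - q) / 2), 0.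
Qed.

Lemma prox_potential (s : R) : 0 < s ->
  exists H : 'rV[R]_d -> R, convex_fn H /\
    forall x, prox_set s H x = [set p x].
Proof.
move=> s0; exists (fun q => S q / s); split.
  move=> x y t t0 t1; rewrite !mulrA -mulrDl ler_wpM2r ?invr_ge0 ?(ltW s0)//.
  apply: S_lub => z; set w := t *: x + (1 - t) *: y.
  (* The points at the same displacement [z - w] from [x] and [y] combine to [z] and have the same
     quadratic term. *)
  have := psi_cvx (z - w + x) (z - w + y) t t0 t1.
  have -> : t *: (z - w + x) + (1 - t) *: (z - w + y) = z.
    by rewrite /w; apply/rowP => i; rewrite !mxE; ring.
  have := S_ub x (z - w + x); have := S_ub y (z - w + y); rewrite !addrK.
  move: (dotv _ _) (psi _) (psi _) (psi _) (S _) (S _) => *; nra.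
have sS q : s * (S q / s) = S q by rewrite mulrC divfK ?gt_eqF.
move=> x; rewrite eqEsubset; split => [q|_ ->] /=.
  move=> /(_ (p x)); rewrite !sS !sqr_enorm.
  (* By the upper bound, the supremum defining [S (p x)] is attained at [x]. *)
  have : S (p x) <= psi x - dotv (p x - x) (p x - x) / 2.
    apply: S_lub => z; have := psi_up x (z - x); rewrite (addrC x) subrK.
    move: (p x) => a; rewrite !dotvE (dotvC z x) (dotvC a x) (dotvC z a); lra.
  (* This test point lies at displacement [x - p x] from [q]; with the gradient inequality,
     minimality of [q] reduces to [dotv (q - p x) (q - p x) <= 0]. *)
  have := S_ub q (x + (q - p x)).
  have := gradient_inequality psi_cvx psi_up x (q - p x).
  move=> h1 h2 h3 h4; apply/eqP; rewrite -subr_eq0; apply/eqP/dotv_eq0/eqP.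
  rewrite eq_le dotv_ge0 andbT; move: h1 h2 h3 h4.
  move: (S q) (S (p x)) (psi (x + (q - p x))) (p x) => S1 S2 P a.
  rewrite !dotvE (dotvC q x) (dotvC a x) (dotvC a q); lra.
move=> y; rewrite !sS !sqr_enorm.
have : S (p x) <= psi x - dotv (p x - x) (p x - x) / 2.
  apply: S_lub => z; have := psi_up x (z - x); rewrite (addrC x) subrK.
  move: (p x) => a; rewrite !dotvE (dotvC z x) (dotvC a x) (dotvC z a); lra.
have := S_ub y x; rewrite !dotvE (dotvC y x); lra.
Qed.

End ProximalMap.

(** * Gradient descent with unit step *)

Section Descent.
Context {R : realType} {d : nat} {psi : 'rV[R]_d -> R} {p : 'rV[R]_d -> 'rV[R]_d}.
Hypothesis psi_cvx : convex_fn psi.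
Hypothesis psi_up : forall x h,
  psi (x + h) <= psi x + dotv (x - p x) h + dotv h h / 2.

Let g x := x - p x.

(** [z - p z] is the gradient at [z]: subtracting it lowers [psi] by at least half its square, and
    where it vanishes the gradient inequality gives minimality. *)
Lemma argmin_fixpoint z : argmin_set psi z <-> p z = z.
Proof.
split=> [zmin|pz x].
  apply/eqP; rewrite eq_sym -subr_eq0; apply/eqP/dotv_eq0/eqP.
  rewrite eq_le dotv_ge0 andbT.
  have := psi_up z (- (z - p z)); have := zmin (z - (z - p z)).
  move: (z - p z) => a; rewrite !dotvE; lra.
have := gradient_inequality psi_cvx psi_up z (x - z).
by rewrite pz subrr dotvC (addrC z) subrK linear0 addr0.
Qed.

Lemma argmin_nonempty :
  (forall M, exists r, forall x, psi x <= M -> `|x| <= r) ->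
  argmin_set psi !=set0.
Proof.
move=> /(_ (psi 0))[r hr].
pose A := [set x : 'rV[R]_d | psi x <= psi 0].
have cA : compact A.
  apply: bounded_closed_compact.
    exists r; split; first exact: num_real.
    by move=> M rM x /hr /le_trans; apply; exact: ltW.
  apply: (@closed_comp _ _ psi [set t | t <= psi 0]); last exact: closed_le.
  by move=> x _; exact: convex_smooth_continuous psi_cvx psi_up x.
have [] := @EVT_min_rV _ _ psi A _ cA.
- by exists 0; exact: lexx.
- by apply: continuous_subspaceT; exact: convex_smooth_continuous psi_cvx psi_up.
move=> z; rewrite inE => zA zmin; exists z => x.
have [xA|/ltW] := leP (psi x) (psi 0); first by apply: zmin; rewrite inE.
exact: le_trans.
Qed.

Section Iterates.
Variables (x0 z : 'rV[R]_d).
Hypothesis zmin : argmin_set psi z.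

Let x k := iter k p x0.
Let G k := dotv (g (x k)) (g (x k)).

Let xS k : x k.+1 = x k - g (x k).
Proof. by apply/rowP => i; rewrite !mxE; ring. Qed.

Let gz : g z = 0.
Proof. by rewrite /g ((argmin_fixpoint z).1 zmin) subrr. Qed.

(** In the strong inequality from [x k.+1] to [x k] the cross terms cancel, so both squared
    gradients are gained; the upper bound alone yields only [G k / 2]. *)
Lemma descent k : (G k + G k.+1) / 2 <= psi (x k) - psi (x k.+1).
Proof.
have := gradient_inequality_strong psi_cvx psi_up (x k.+1) (x k).
have -> : x k - x k.+1 = g (x k) by rewrite xS; apply/rowP => i; rewrite !mxE; ring.
rewrite -!/(g _) /G; move: (g (x k)) (g (x k.+1)) => a b.
rewrite !dotvE (dotvC b a); lra.
Qed.

Lemma grad_decreasing k : G k.+1 <= G k.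
Proof.
have := grad_cocoercive psi_cvx psi_up (x k) (x k.+1).
have := dotv_ge0 (g (x k.+1) - g (x k)).
have -> : x k.+1 - x k = - g (x k) by rewrite xS; apply/rowP => i; rewrite !mxE; ring.
rewrite -!/(g _) /G; move: (g (x k)) (g (x k.+1)) => a b.
rewrite !dotvE (dotvC b a); lra.
Qed.

(** The gap is at most [dotv (g (x k)) (x k - z) - G k / 2], which is half the decrease of the
    squared distance to [z]. *)
Lemma value_distance k : psi (x k.+1) - psi z <=
  (dotv (x k - z) (x k - z) - dotv (x k.+1 - z) (x k.+1 - z)) / 2.
Proof.
have := psi_up (x k) (- g (x k)); rewrite -/(g _) -xS.
have := gradient_inequality psi_cvx psi_up (x k) (z - x k); rewrite -/(g _).
rewrite (addrC (x k)) subrK !xS; move: (g (x k)) => a; move: (x k) => b.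
rewrite !dotvE (dotvC a b) (dotvC z b) (dotvC z a); lra.
Qed.

(** Telescopes [value_distance]; values decrease, so each of the [k] gaps is at least the last. *)
Lemma value_rate k :
  k%:R * (psi (x k) - psi z) + dotv (x k - z) (x k - z) / 2
    <= dotv (x0 - z) (x0 - z) / 2.
Proof.
elim: k => [|k ih]; first by rewrite mul0r add0r.
have := descent k; have := value_distance k.
have := dotv_ge0 (g (x k)); have := dotv_ge0 (g (x k.+1)).
rewrite -/(G k) -/(G k.+1) -(natr1 k) => G0 G1 vd dk.
have : k%:R * (psi (x k.+1) - psi z) <= k%:R * (psi (x k) - psi z).
  by rewrite ler_wpM2l//; lra.
by lra.
Qed.

Lemma fejer k : dotv (x k.+1 - z) (x k.+1 - z) <= dotv (x k - z) (x k - z).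
Proof. by have := value_distance k; have := zmin (x k.+1); lra. Qed.

(** Each of the [j] steps after [m] gains at least the last squared gradient. The extra half is the
    gap left at [m + j], by the strong inequality at [z], where [g] vanishes. *)
Lemma gap_grad m j : (j%:R + 2^-1) * G (m + j)%N <= psi (x m) - psi z.
Proof.
suff H : j%:R * G (m + j)%N <= psi (x m) - psi (x (m + j)%N).
  have := gradient_inequality_strong psi_cvx psi_up z (x (m + j)%N).
  rewrite -!/(g _) gz subr0 -/(G _) dotvC linear0; lra.
elim: j => [|j ih]; first by rewrite mul0r addn0 subrr.
rewrite addnS -(natr1 j); have := descent (m + j)%N.
have dG := grad_decreasing (m + j)%N.
have : j%:R * G (m + j).+1 <= j%:R * G (m + j)%N by rewrite ler_wpM2l.
by lra.
Qed.

(* The gap at step [m] is at most [|x0 - z|^2 / (2m)] and dominates the [2(k - m) + 1] halves of squared gradients between [m] and [k]; [m] is the upper half of [k]. *)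
Lemma grad_rate k : (0 < k)%N ->
  k.+1%:R ^+ 2 * G k <= 4 * dotv (x0 - z) (x0 - z).
Proof.
move=> k0.
have H m j : m%:R * (2 * j%:R + 1) * G (m + j)%N <= dotv (x0 - z) (x0 - z).
  have := gap_grad m j; have := value_rate m; have := dotv_ge0 (x m - z).
  have m0 : 0 <= m%:R :> R by [].
  move: (G _) (psi _) (psi _) (dotv _ _) (dotv _ _) m%:R m0 j%:R => *; nra.
have G0 : 0 <= G k := dotv_ge0 _.
have Ek : (uphalf k + k./2 = k)%N by rewrite uphalf_half -addnA addnn odd_double_half.
have := H (uphalf k) (k./2); rewrite Ek.
(* What remains is an inequality between natural numbers, checked for each parity of [k]; it is an
   equality at [k = 1]. *)
suff : k.+1%:R ^+ 2 <= 4 * ((uphalf k)%:R * (2 * (k./2)%:R + 1)) :> R.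
  by move: (dotv _ _) => D h1 h2; rewrite (le_trans (ler_wpM2r G0 h1))//; lra.
rewrite -natrX -[X in _ * (_ * (_ + X))]/(1%:R) -[X in X * (_ * _)]/(4%:R) -natrM -natrD -!natrM ler_nat.
rewrite -[X in X.+1]Ek uphalf_half; move: Ek; rewrite uphalf_half.
case: (odd k) (k./2) => -[|j] /=; rewrite ?addn0 ?add0n ?add1n; nia.
Qed.

End Iterates.

(** Fejer monotonicity keeps the iterates in a compact set. A cluster point is a minimizer because
    the gradients tend to 0, and monotonicity of the distance to that point turns clustering into
    convergence. *)
Lemma gradient_descent_cvg x0 : argmin_set psi !=set0 ->
  exists2 z, argmin_set psi z & (fun k => iter k p x0) @ \oo --> z.
Proof.
move=> [z0 z0min]; pose x k := iter k p x0.
pose D := dotv (x0 - z0) (x0 - z0).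
have x_bnd k : `|x k| <= `|z0| + Num.sqrt D.
  rewrite -[x k](subrK z0) addrC (le_trans (ler_normD _ _))// lerD2l.
  rewrite (le_trans (norm_le_enorm _))// ler_sqrt ?dotv_ge0// {}/D.
  by elim: k => [//|k]; apply: le_trans; exact: fejer.
pose A := [set v : 'rV[R]_d | `|v| <= `|z0| + Num.sqrt D].
have cA : compact A.
  apply: bounded_closed_compact.
    exists (`|z0| + Num.sqrt D); split; first exact: num_real.
    by move=> M rM v /le_trans; apply; exact: ltW.
  apply: (@closed_comp _ _ (fun v : 'rV[R]_d => `|v|) [set t | t <= `|z0| + Num.sqrt D]).
    by move=> v _; exact: norm_continuous.
  exact: closed_le.
have [] := cA (x @ \oo) _; first by exists 0%N => // k _; exact: x_bnd.
move=> y [_ y_cluster].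
have near_y e N : 0 < e -> exists2 k, (N <= k)%N & dotv (x k - y) (x k - y) < e.
  move=> e0; have [] := y_cluster (x @` [set k | (N <= k)%N]) _ _ (nbhs_dotv y e e0).
    by exists N => // k Nk; exists k.
  by move=> _ [[k Nk <-]]; exists k.
have y_min : argmin_set psi y.
  apply/argmin_fixpoint; apply/eqP; rewrite eq_sym -subr_eq0; apply/eqP/dotv_eq0.
  apply/eqP; rewrite eq_le dotv_ge0 andbT; apply/ler_addgt0Pr => e e0; rewrite add0r.
  (* [g] is 1-Lipschitz, so the square of [g y] is at most twice that of [y - x k] plus twice that
     of [g (x k)]; each square is made at most [e / 4]. *)
  have e40 : 0 < e / 4 by rewrite divr_gt0.
  have D0 : 0 <= D := dotv_ge0 _.
  have [k hk /ltW ky] := near_y (e / 4) (Num.truncn (4 * D / (e / 4))).+1 e40.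
  have k0 : (0 < k)%N by rewrite (leq_trans _ hk).
  have : dotv (g (x k)) (g (x k)) <= e / 4.
    have /ltW hk2 : 4 * D / (e / 4) < k%:R.
      by apply: lt_le_trans (truncnS_gt _) _; rewrite ler_nat.
    move: hk2; rewrite ler_pdivrMr// => hk2.
    have := grad_rate x0 z0 z0min k k0; rewrite -/D -/(x k) -/(g _) => hG.
    have : (1 : R) <= k%:R by rewrite ler1n.
    have := dotv_ge0 (g (x k)).
    move: hG hk2; rewrite -(natr1 k); move: (dotv _ _) k%:R => *; nra.
  have := grad_cocoercive psi_cvx psi_up (x k) y; move: ky.
  have := dotv_ge0 (g y - g (x k) - (y - x k)).
  have := dotv_ge0 (g y - g (x k) - g (x k)).
  rewrite -/(g y) -/(g (x k)) -[x k - y]opprB.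
  move: (y - x k) (g y) (g (x k)) => h b a.
  rewrite !dotvE (dotvC b a) (dotvC h a) (dotvC h b); lra.
exists y => //; apply/cvgrPdist_lt => e e0.
have [K _ hK] := near_y (e ^+ 2) 0%N (exprn_gt0 _ e0).
exists K => // k /= /subnK <-; rewrite distrC (le_lt_trans (norm_le_enorm _))//.
rewrite -(ltr_pXn2r (n := 2)) ?nnegrE ?enorm_ge0 ?(ltW e0)// sqr_enorm.
apply: le_lt_trans hK; elim: (k - K)%N => [//|i].
by apply: le_trans; rewrite addSn; exact: fejer.
Qed.

End Descent.

(** * Rescaling by [lam]: all conclusions for an abstract envelope [F] and map [p] *)

Section ProximalScheme.
Context {R : realType} {d : nat} {lam : R} {F : 'rV[R]_d -> R} {p : 'rV[R]_d -> 'rV[R]_d}.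
Hypothesis lam0 : 0 < lam.
Hypothesis F_cvx : convex_fn F.
Hypothesis F_up : forall x h,
  lam * F (x + h) <= lam * F x + dotv (x - p x) h + dotv h h / 2.
Hypothesis F_quad : forall q, exists B, forall z,
  lam * F z - dotv (z - q) (z - q) / 2 <= B.
Hypothesis F_coercive : forall M, exists r, forall x, F x <= M -> `|x| <= r.

Let psi x := lam * F x.

Let psi_cvx : convex_fn psi.
Proof.
move=> x y t t0 t1; have := F_cvx x y t t0 t1.
by rewrite /psi -(ler_pM2l lam0) => /le_trans; apply; lra.
Qed.

Let psi_up : forall x h,
  psi (x + h) <= psi x + dotv (x - p x) h + dotv h h / 2 := F_up.

Let argmin_psi : argmin_set psi = argmin_set F.
Proof.
by apply/seteqP; split=> z zmin y; have := zmin y; rewrite /psi ler_pM2l.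
Qed.

Lemma is_diff_proximal x : is_diff x F (fun h => lam^-1 * dotv (x - p x) h).
Proof.
have -> : F = lam^-1 *: psi.
  by apply/funext => y; rewrite /psi /= fctE scalerA mulVf ?gt_eqF ?scale1r.
have ? := is_diff_psi psi_cvx psi_up x.
exact: is_diff_eq.
Qed.

Lemma grad_proximal x : grad F x = lam^-1 *: (x - p x).
Proof.
apply/rowP => i; rewrite /grad !mxE.
by have [_ ->] := is_diff_proximal x; rewrite dotv_delta !mxE.
Qed.

Lemma proximal_scheme (s : R) (x0 : 'rV[R]_d) : 0 < s ->
  (exists H : 'rV[R]_d -> R, convex_fn H /\
     forall x, prox_set s H x = [set p x]) /\
  firmly_nonexpansive p /\
  exists xs : 'rV[R]_d,
    argmin_set F xs /\
    (fun k : nat => iter k p x0) @ \oo --> xs /\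
    forall k : nat, (0 < k)%N ->
      F (iter k p x0) - F xs <= (dist_set x0 (argmin_set F)) ^+ 2 / (2 * lam * k%:R) /\
      differentiable F (iter k p x0) /\
      enorm (grad F (iter k p x0))
        <= 2 * dist_set x0 (argmin_set F) / (lam * k.+1%:R).
Proof.
move=> s0; split; first exact: prox_potential psi_cvx psi_up F_quad s s0.
split; first exact: prox_firmly_nonexpansive psi_cvx psi_up.
have psi_coercive M : exists r, forall x, psi x <= M -> `|x| <= r.
  have [r hr] := F_coercive (M / lam); exists r => x.
  by rewrite /psi mulrC -ler_pdivlMr//; exact: hr.
have A0 := argmin_nonempty psi_cvx psi_up psi_coercive.
have [xs xsmin xs_cvg] := gradient_descent_cvg psi_cvx psi_up x0 A0.
exists xs; rewrite -argmin_psi; split=> //; split=> // k k0.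
have kR : (0 : R) < k%:R by rewrite ltr0n.
split; last split.
- rewrite ler_pdivlMr ?mulr_gt0//; apply: le_sqr_dist_set => // z zmin.
  have := value_rate psi_cvx psi_up x0 z k.
  have := dotv_ge0 (iter k p x0 - z).
  have -> : psi z = psi xs by apply/eqP; rewrite eq_le zmin xsmin.
  rewrite /psi; lra.
- by have [] := is_diff_proximal (iter k p x0).
- rewrite grad_proximal ler_pdivlMr ?mulr_gt0// mulrC -ler_pdivrMl//.
  apply: le_dist_set => // z zmin; rewrite ler_pdivrMl//.
  have pos : 0 <= lam * k.+1%:R by rewrite mulr_ge0// ltW.
  rewrite -(@ler_pXn2r _ 2) ?nnegrE ?mulr_ge0 ?enorm_ge0 ?(ltW lam0)//.
  rewrite !exprMn !sqr_enorm dotvZl dotvZr.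
  have := grad_rate psi_cvx psi_up x0 z zmin k k0.
  have -> : lam ^+ 2 * k.+1%:R ^+ 2 * (lam^-1 * (lam^-1 * dotv (iter k p x0 - p (iter k p x0)) (iter k p x0 - p (iter k p x0)))) = k.+1%:R ^+ 2 * dotv (iter k p x0 - p (iter k p x0)) (iter k p x0 - p (iter k p x0)).
    by field; rewrite gt_eqF.
  by lra.
Qed.

End ProximalScheme.

(** * Iterated Lebesgue integrals as integrals on a measure space *)

(* Among the instances of [product_measure1] competing for the key, inference retains the one for subprobabilities, hence this explicit construction. *)
Lemma product_sigma_finite {R : realType} {d1 d2} {T1 : measurableType d1}
    {T2 : measurableType d2} (m1 : {sigma_finite_measure set T1 -> \bar R})
    (m2 : {sigma_finite_measure set T2 -> \bar R}) :
  sigma_finite setT (product_measure1 m1 m2).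
Proof.
have /sigma_finiteP[F [TF ndF Foo]] := sigma_finiteT m1.
have /sigma_finiteP[G [TG ndG Goo]] := sigma_finiteT m2.
exists (fun n => F n `*` G n) => [|n].
  apply/seteqP; split=> // -[x y] _.
  have [i _ Fx] : (\bigcup_i F i) x by rewrite -TF.
  have [j _ Gy] : (\bigcup_i G i) y by rewrite -TG.
  exists (maxn i j) => //; split.
    by have /subsetPset := ndF _ _ (leq_maxl i j); apply.
  by have /subsetPset := ndG _ _ (leq_maxr i j); apply.
have [[mF Fn] [mG Gn]] := (Foo n, Goo n); split; first exact: measurableX.
by rewrite product_measure1E// lte_mul_pinfty// ge0_fin_numE.
Qed.

Definition product_sigma_finite_measure {R : realType} {d1 d2} {T1 : measurableType d1}
    {T2 : measurableType d2} (m1 : {sigma_finite_measure set T1 -> \bar R})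
    (m2 : {sigma_finite_measure set T2 -> \bar R}) :
    {sigma_finite_measure set (T1 * T2)%type -> \bar R} :=
  HB.pack (product_measure1 m1 m2)
    (Measure_isSigmaFinite.Build _ _ _ (product_measure1 m1 m2)
      (product_sigma_finite m1 m2)).

(** Realizes the recursive [iint] by one measure on an iterated product, [Y] reading off the row
    vector, so that linearity, monotonicity and dominated convergence apply. The mass of unit cubes
    serves to bound Gaussian means from below. *)
Lemma iint_measure (R : realType) (d : nat) :
  exists (disp : measure_display) (T : measurableType disp)
    (mu : {sigma_finite_measure set T -> \bar R}) (Y : T -> 'rV[R]_d),
  [/\ forall i, measurable_fun [set: T] (fun t => Y t ord0 i),
      forall g : 'rV[R]_d -> \bar R, (forall y, 0 <= g y)%E ->
        measurable_fun [set: T] (fun t => g (Y t)) -> iint g = (\int[mu]_t g (Y t))%E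
    & forall a : 'rV[R]_d,
        mu [set t | forall i, a ord0 i <= Y t ord0 i <= a ord0 i + 1] = 1%E].
Proof.
elim: d => [|d [disp [T [mu [Y [mY iintE boxE]]]]]].
  exists _, unit, (dirac tt), (fun=> 0); split => [[]//|g g0 mg|a].
    by rewrite integral_dirac// diracT mul1e.
  by rewrite /= diracE mem_set//= => -[].
pose Y' (u : measurableTypeR R * T) : 'rV[R]_d.+1 :=
  \row_i (if unlift ord0 i is Some j then Y u.2 ord0 j else u.1).
pose leb : {sigma_finite_measure set (measurableTypeR R) -> \bar R} := @lebesgue_measure R.
exists _, (measurableTypeR R * T)%type, (product_sigma_finite_measure leb mu), Y'; split.
- move=> i; case: (unliftP ord0 i) => [j ->|->].
    rewrite (_ : (fun _ => _) = (fun t => Y t ord0 j) \o snd).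
      exact: measurableT_comp.
    by apply/funext => u; rewrite mxE liftK.
  rewrite (_ : (fun _ => _) = fst); first exact: measurable_fst.
  by apply/funext => u; rewrite mxE unlift_none.
- move=> g g0 mg; rewrite fubini_tonelli1//=.
  apply: eq_integral => t _; rewrite iintE//.
  exact: (measurableT_comp mg (pair1_measurable t)).
- move=> a; pose b : 'rV[R]_d := \row_j a ord0 (lift ord0 j).
  have -> : [set u | forall i, a ord0 i <= Y' u ord0 i <= a ord0 i + 1] =
    `[a ord0 ord0, a ord0 ord0 + 1] `*`
    [set t | forall i, b ord0 i <= Y t ord0 i <= b ord0 i + 1].
    apply/seteqP; split => [[u v] /= H|[u v] /= [H1 H2] i].
      split; first by have := H ord0; rewrite mxE unlift_none in_itv.
      by move=> i; have := H (lift ord0 i); rewrite !mxE liftK.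
    rewrite mxE; case: (unliftP ord0 i) => [j ->|->]; last by move: H1; rewrite in_itv.
    by have := H2 j; rewrite mxE.
  rewrite -[LHS]/(product_measure1 leb mu (_ `*` _)) product_measure1E//=; last first.
    rewrite (_ : [set _ | _] = \bigcap_i
      ((fun t => Y t ord0 i) @^-1` `[b ord0 i, b ord0 i + 1])); last first.
      by apply/seteqP; split => t /= H i; [move=> _|]; have := H i; rewrite /= in_itv//=; apply.
    apply: fin_bigcap_measurable => [|i _]; first exact: finite_finset.
    by rewrite -[X in measurable X]setTI; exact: mY.
  rewrite boxE mule1 lebesgue_measure_itv /= lte_fin ltrDl ltr01.
  by rewrite -EFinD addrAC subrr add0r.
Qed.

(** * Measurability of continuous functions of a measurable vector *)

Lemma nbhs_box {R : realType} {d} (x : 'rV[R]_d) (U : set 'rV[R]_d) : nbhs x U ->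
  exists2 e : R, 0 < e & forall v : 'rV[R]_d, (forall i, `|x ord0 i - v ord0 i| < e) -> U v.
Proof.
move=> /nbhs_ballP[e /= e0 eU]; exists e => // v xv; apply: eU.
rewrite mx_norm_ball /ball_/= [ltLHS]/Num.norm/= mx_normrE.
by apply/bigmax_ltP; split=> // -[i j] _; rewrite ord1 !mxE.
Qed.

(** Measurability is given coordinatewise, so [U] is written as the countable union of the boxes
    inside it with rational centre and radius [n.+1%:R^-1]. *)
Lemma measurable_preimage_open {R : realType} {d} {disp} {T : measurableType disp}
    (Y : T -> 'rV[R]_d) (U : set 'rV[R]_d) :
  (forall i, measurable_fun [set: T] (fun t => Y t ord0 i)) -> open U ->
  measurable (Y @^-1` U).
Proof.
move=> mY oU.
pose box (qn : 'rV[rat]_d * nat) : set 'rV[R]_d :=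
  [set v | forall i, `|ratr (qn.1 ord0 i) - v ord0 i| < qn.2.+1%:R^-1].
have -> : Y @^-1` U = \bigcup_qn (if `[< box qn `<=` U >] then Y @^-1` box qn else set0).
  apply/seteqP; split => [t /= Ut|t [qn _]]; last first.
    by case: asboolP => // boxU /=; exact: boxU.
  have [e e0 eU] := nbhs_box (Y t) U (open_nbhs_nbhs (conj oU Ut)).
  pose n := Num.truncn (2 / e).
  have nE : 2 * n.+1%:R^-1 < e.
    by rewrite ltr_pdivrMr// mulrC -ltr_pdivrMr// truncnS_gt.
  have n0 : 0 < n.+1%:R^-1 :> R by [].
  have /choice[q hq] : forall i, exists q : rat, `|ratr q - Y t ord0 i| < n.+1%:R^-1.
    move=> i; have [] := @rat_in_itvoo R (Y t ord0 i - n.+1%:R^-1) (Y t ord0 i + n.+1%:R^-1).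
      by rewrite ltrBlDr -addrA ltrDl addr_gt0.
    by move=> q; rewrite in_itv/= => /andP[h1 h2]; exists q; rewrite ltr_distl h1 h2.
  exists (\row_i q i, n) => //; case: asboolP => [_ i /=|]; first by rewrite mxE; exact: hq.
  case=> v boxv; apply: eU => i; have := boxv i; have := hq i; rewrite /= !mxE.
  rewrite !ltr_distl => /andP[h1 h2] /andP[h3 h4]; apply/andP; split; move: nE h1 h2 h3 h4; move: (n.+1%:R^-1) => r; lra.
apply: countable_bigcupT_measurable => // qn; case: asboolP => // _.
rewrite (_ : _ @^-1` _ = \bigcap_i ((fun t => Y t ord0 i) @^-1`
  ball (ratr (qn.1 ord0 i) : R) qn.2.+1%:R^-1)); last first.
  by apply/seteqP; split => t /= H i; [move=> _|]; have := H i; rewrite /ball/=; apply.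
apply: fin_bigcap_measurable => [|i _]; first exact: finite_finset.
by rewrite -[X in measurable X]setTI; apply: mY => //; exact: measurable_ball.
Qed.

Lemma continuous_measurable_rV {R : realType} {d} {disp} {T : measurableType disp}
    (Y : T -> 'rV[R]_d) (f : 'rV[R]_d -> R) :
  (forall i, measurable_fun [set: T] (fun t => Y t ord0 i)) -> continuous f ->
  measurable_fun [set: T] (fun t => f (Y t)).
Proof.
move=> mY cf; apply: (measurability _ (RGenOpens.measurableE R)).
move=> _ [_ [a [b ->] <-]]; rewrite setTI.
apply: (@measurable_preimage_open _ _ _ _ Y (f @^-1` `]a, b[)) => //.
by apply: open_comp => [x _|]; [exact: cf|exact: interval_open].
Qed.

(** * Gaussian convolution *)

Section Gaussian.
Context {R : realType} {d : nat} {disp : measure_display} {T : measurableType disp}.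
Context {mu : {measure set T -> \bar R}} {Y : T -> 'rV[R]_d}.
Hypothesis mY : forall i, measurable_fun [set: T] (fun t => Y t ord0 i).
Hypothesis iintE : forall g : 'rV[R]_d -> \bar R, (forall y, 0 <= g y)%E ->
  measurable_fun [set: T] (fun t => g (Y t)) -> iint g = (\int[mu]_t g (Y t))%E.
Hypothesis boxE : forall a : 'rV[R]_d,
  mu [set t | forall i, a ord0 i <= Y t ord0 i <= a ord0 i + 1] = 1%E.

Local Notation intble g := (mu.-integrable [set: T] (EFin \o g)).

(** [fine] sends infinite values to 0, so the difference defining [Rint] is the integral once both
    parts are finite. *)
Lemma RintE (g : 'rV[R]_d -> R) : intble (fun t => g (Y t)) ->
  Defs.Rint g = \int[mu]_t g (Y t).
Proof.
move=> ig; have mg : measurable_fun [set: T] (fun t => g (Y t)).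
  by apply/measurable_EFinP; exact: measurable_int ig.
rewrite /Defs.Rint.
rewrite iintE; last 2 first.
- by move=> y; rewrite lee_fin le_max lexx orbT.
- by apply/measurable_EFinP; exact: measurable_maxr.
rewrite iintE; last 2 first.
- by move=> y; rewrite lee_fin le_max lexx orbT.
- by apply/measurable_EFinP; apply: measurable_maxr => //; exact: measurableT_comp.
rewrite /Rintegral [X in _ = fine X]integralE [RHS]fineB ?integrable_pos_fin_num ?integrable_neg_fin_num//.
by congr (_ - _); congr fine; apply: eq_integral => t _; rewrite EFin_max ?funeposE ?funenegE.
Qed.

Let intbleZl a (g : T -> R) : intble g -> intble (fun t => a * g t).
Proof. by move=> ig; exact: (integrableZl measurableT a ig). Qed.

Let intbleD (g1 g2 : T -> R) : intble g1 -> intble g2 -> intble (fun t => g1 t + g2 t).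
Proof. by move=> i1 i2; exact: (integrableD measurableT i1 i2). Qed.

Context {lam del : R} {f : 'rV[R]_d -> R}.
Hypothesis lam0 : 0 < lam.
Hypothesis del0 : 0 < del.
Hypothesis f_cont : continuous f.
Hypothesis f_int : (iint (fun y : 'rV[R]_d => (expR (- f y / del))%:E) < +oo)%E.

Let s := lam * del.
Let s0 : 0 < s. Proof. exact: mulr_gt0. Qed.
Let c : R := (Num.sqrt (2 * pi * s)) ^- d.
Let c0 : 0 < c.
Proof. by rewrite invr_gt0 exprn_gt0// sqrtr_gt0 !mulr_gt0 ?pi_gt0. Qed.

Let w (y : 'rV[R]_d) := expR (- f y / del).
Let k := @gauss_dens R d s.

Lemma gauss_densE (x y : 'rV[R]_d) : gauss_dens s x y = c * expR (- dotv (y - x) (y - x) / (2 * s)).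
Proof. by rewrite /gauss_dens sqr_enorm. Qed.

Let mk x : measurable_fun [set: T] (fun t => k x (Y t)).
Proof.
under eq_fun do rewrite /k gauss_densE.
apply: measurable_funM => //; apply: measurableT_comp => //.
apply: measurable_funM => //; apply: measurableT_comp => //.
apply: measurable_sum => i; under eq_fun do rewrite !mxE.
by apply: measurable_funM; apply: measurable_funD.
Qed.

Let mw : measurable_fun [set: T] (fun t => w (Y t)).
Proof.
apply: measurableT_comp => //; apply: measurable_funM => //.
by apply: measurableT_comp => //; exact: continuous_measurable_rV.
Qed.

Let k_ge0 x y : 0 <= k x y.
Proof. by rewrite /k gauss_densE mulr_ge0 ?expR_ge0 ?ltW. Qed.

Let k_le x y : k x y <= c.
Proof.
rewrite /k gauss_densE ler_piMr ?(ltW c0)// -expR0 ler_expR mulNr oppr_le0.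
by rewrite divr_ge0 ?dotv_ge0// mulr_ge0// ltW.
Qed.

Let iw : intble (fun t => w (Y t)).
Proof.
apply/integrableP; split; first exact/measurable_EFinP.
move: f_int; rewrite iintE => [|y|]; last 2 first.
- by rewrite lee_fin expR_ge0.
- exact/measurable_EFinP.
by apply: le_lt_trans; under eq_integral do rewrite /= ger0_norm ?expR_ge0//.
Qed.

(** The weight [w], integrable by (A2), dominates the integrands up to a constant. *)
Let intble_le_w (C : R) (g : 'rV[R]_d -> R) :
  measurable_fun [set: T] (fun t => g (Y t)) ->
  (forall y, `|g y| <= C * w y) -> intble (fun t => g (Y t)).
Proof.
move=> mg gC; apply: (@le_integrable _ _ _ mu _ _ _ (fun t => C%:E * (w (Y t))%:E)%E) => //.
- exact/measurable_EFinP.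
- by move=> t _ /=; rewrite lee_fin (le_trans (gC _))// ler_norm.
- exact: integrableZl iw.
Qed.

Let ikw x : intble (fun t => k x (Y t) * w (Y t)).
Proof.
apply: (intble_le_w c (fun y => k x y * w y)); first exact: measurable_funM.
by move=> y; rewrite ger0_norm ?mulr_ge0 ?expR_ge0// ler_wpM2r ?expR_ge0.
Qed.

(* AM-GM and [1 + u <= exp u] give [|t| <= (s / 2 + 1) exp (t^2 / (2 s))] for [t = y_i - x_i]. *)
Let coord_gauss_le x (y : 'rV[R]_d) i :
  k x y * `|y ord0 i| <= c * (`|x ord0 i| + (s / 2 + 1)).
Proof.
rewrite -[y ord0 i](subrK (x ord0 i)).
apply: (@le_trans _ _ (k x y * (`|y ord0 i - x ord0 i| + `|x ord0 i|))).
  by rewrite ler_wpM2l// ler_normD.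
rewrite mulrDr addrC mulrDr lerD//; first by rewrite ler_wpM2r.
rewrite /k gauss_densE -mulrA ler_pM2l// mulrC mulNr.
set t := `|_|; set u := dotv _ _ / (2 * s).
rewrite expRN ler_pdivrMr ?expR_gt0//.
have tu : t ^+ 2 / (2 * s) <= u.
  rewrite ler_pM2r ?invr_gt0 ?mulr_gt0//.
  rewrite -sqr_enorm lerXn2r ?nnegrE ?enorm_ge0 ?normr_ge0//.
  by have := coord_le_enorm (y - x) i; rewrite !mxE.
apply: (@le_trans _ _ ((s / 2 + 1) * (1 + u))); last first.
  by rewrite ler_wpM2l ?expR_ge1Dx// addr_ge0// divr_ge0// ltW.
have u0 : 0 <= u by rewrite divr_ge0 ?dotv_ge0// mulr_ge0// ltW.
have : t ^+ 2 <= 2 * s * u by rewrite mulrC -ler_pdivrMr// mulr_gt0.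
have := sqr_ge0 (t - s); rewrite sqrrB => ts tsu.
have : t <= u + s / 2 by rewrite -(ler_pM2l s0); lra.
have : 0 <= s * u by rewrite mulr_ge0// ltW.
by lra.
Qed.

Let ikyw x i : intble (fun t => k x (Y t) * (Y t ord0 i * w (Y t))).
Proof.
apply: (intble_le_w (c * (`|x ord0 i| + (s / 2 + 1))) (fun y => k x y * (y ord0 i * w y))).
  by apply: measurable_funM => //; exact: measurable_funM.
move=> y; rewrite mulrA normrM (ger0_norm (expR_ge0 _)) ler_wpM2r ?expR_ge0//.
by rewrite normrM (ger0_norm (k_ge0 _ _)).
Qed.

Let G x := \int[mu]_t (k x (Y t) * w (Y t)).
Let N x i := \int[mu]_t (k x (Y t) * (Y t ord0 i * w (Y t))).
Let p := zprox lam del f.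

Let soft_envE x : soft_env lam del f x = - del * ln (G x).
Proof. by rewrite /soft_env /gexp RintE//; exact: ikw. Qed.

Let zproxE x i : p x ord0 i = N x i / G x.
Proof. rewrite /p mxE /gexp RintE; last exact: ikyw. by rewrite RintE; last exact: ikw. Qed.

(** On the unit cube at [q] turned towards [x], the cross terms of [Y t - q] and [x - q] are
    nonnegative, so the squared distance to [x] is at most [d%:R + dotv (x - q) (x - q)]. The
    coefficient of the last term must be exactly 1 for [soft_env_quadratic_bound]. *)
Lemma gauss_lower_bound (q : 'rV[R]_d) :
  exists2 K, 0 < K & forall x, K * expR (- dotv (x - q) (x - q) / (2 * s)) <= G x.
Proof.
(* [A] contains the cubes for all positions of [x], so the maximum of [f] on [A] gives a [K]
   independent of [x]. *)
pose A := [set v : 'rV[R]_d | forall i, `[q ord0 i - 1, q ord0 i + 1]%classic (v ord0 i)].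
have cA : compact A by apply: (@rV_compact R d (fun i => `[q ord0 i - 1, q ord0 i + 1]%classic)) => i; apply: segment_compact.
have A0 : A !=set0 by exists q => i; rewrite /= in_itv/=; apply/andP; split; lra.
have cf : {within A, continuous f} by exact: continuous_subspaceT.
have [v _ vmax] := EVT_max_rV A0 cA cf.
pose K := c * expR (- d%:R / (2 * s)) * w v.
have K0 : 0 < K by rewrite !mulr_gt0 ?expR_gt0.
exists K => // x; pose a : 'rV[R]_d := \row_i (if q ord0 i <= x ord0 i then q ord0 i else q ord0 i - 1).
pose B := [set t | forall i, a ord0 i <= Y t ord0 i <= a ord0 i + 1].
have muB : mu B = 1%E := boxE a.
have mB : measurable B.
  rewrite (_ : B = \bigcap_i ((fun t => Y t ord0 i) @^-1` `[a ord0 i, a ord0 i + 1])).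
    apply: fin_bigcap_measurable => [|i _]; first exact: finite_finset.
    by rewrite -[X in measurable X]setTI; exact: mY.
  by apply/seteqP; split => t /= H i; [move=> _|]; have := H i; rewrite /= in_itv//=; apply.
set K' := K * _.
have iB : intble (fun t => K' * \1_B t).
  apply: intbleZl; apply/integrableP; split.
    by apply/measurable_EFinP.
  under eq_integral do rewrite /= ger0_norm//.
  by rewrite integral_indic// setIT muB ltry.
have -> : K' = \int[mu]_t (K' * \1_B t).
  rewrite /Rintegral; under eq_integral do rewrite EFinM.
  rewrite ge0_integralZl//; last 2 first.
  - by apply/measurable_EFinP.
  - by rewrite lee_fin mulr_ge0 ?expR_ge0// ltW.
  by rewrite integral_indic// setIT muB mule1.
apply: le_Rintegral => //.
move=> t _; rewrite indicE; case: (boolP (t \in B)) => [|_]; last first.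
  by rewrite mulr0 mulr_ge0 ?expR_ge0.
rewrite inE mulr1 => tB.
have Ya i : [/\ `|Y t ord0 i - q ord0 i| <= 1
    & 0 <= (Y t ord0 i - q ord0 i) * (x ord0 i - q ord0 i)].
  have := tB i; rewrite !mxE ler_norml; case: (leP (q ord0 i) (x ord0 i)) => qx /= /andP[h1 h2].
    by split; [apply/andP; split; lra|rewrite mulr_ge0//; lra].
  by split; [apply/andP; split; lra|rewrite mulr_le0//; lra].
have wY : w v <= w (Y t).
  rewrite ler_expR ler_pM2r ?invr_gt0// lerN2 vmax// inE => i /=.
  by have [+ _] := Ya i; rewrite in_itv/= ler_norml => /andP[? ?]; apply/andP; split; lra.
have dY : dotv (Y t - x) (Y t - x) <= d%:R + dotv (x - q) (x - q).
  rewrite -[X in X%:R]card_ord -sumr_const -big_split/= ler_sum// => i _.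
  have [h1 h2] := Ya i; rewrite !mxE.
  have : (Y t ord0 i - q ord0 i) ^+ 2 <= 1 by rewrite -real_normK ?num_real// exprn_ile1.
  by lra.
have -> : K' = c * (expR (- d%:R / (2 * s)) * expR (- dotv (x - q) (x - q) / (2 * s))) * w v.
  by rewrite /K' /K; ring.
have cE : 0 <= c by exact: ltW.
rewrite /k gauss_densE -expRD; apply: ler_pM => //; first by rewrite mulr_ge0 ?expR_ge0.
  exact: expR_ge0.
rewrite ler_wpM2l// ler_expR -mulrDl ler_pM2r ?invr_gt0 ?mulr_gt0//; lra.
Qed.

Let G_gt0 x : 0 < G x.
Proof.
have [K K0] := gauss_lower_bound 0; move/(_ x); apply: lt_le_trans.
by rewrite mulr_gt0 ?expR_gt0.
Qed.

(** [p x] is the barycentre of the weighted Gaussian at [x]. Induction on a list of indices brings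
    in the coordinates one by one. *)
Let moment0 x h : intble (fun t => dotv (Y t - p x) h * (k x (Y t) * w (Y t))) /\
  \int[mu]_t (dotv (Y t - p x) h * (k x (Y t) * w (Y t))) = 0.
Proof.
suff H (r : seq 'I_d) :
    intble (fun t => \sum_(i <- r) (Y t - p x) ord0 i * h ord0 i * (k x (Y t) * w (Y t))) /\
    \int[mu]_t (\sum_(i <- r) (Y t - p x) ord0 i * h ord0 i * (k x (Y t) * w (Y t))) = 0.
  rewrite (_ : (fun t => _) = fun t => \sum_(i < d) (Y t - p x) ord0 i * h ord0 i * (k x (Y t) * w (Y t))).
    exact: H.
  by apply/funext => t; rewrite mulr_suml.
elim: r => [|i r [ir Ir]].
  rewrite (_ : (fun t => _) = cst 0); last by apply/funext => t; rewrite big_nil.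
  by split; [exact: integrable0|rewrite Rintegral_cst// mul0r].
pose gi t := h ord0 i * (k x (Y t) * (Y t ord0 i * w (Y t))) +
  (- (p x ord0 i * h ord0 i)) * (k x (Y t) * w (Y t)).
have giE t : (Y t - p x) ord0 i * h ord0 i * (k x (Y t) * w (Y t)) = gi t.
  by rewrite /gi !mxE; ring.
have i1 : intble (fun t => h ord0 i * (k x (Y t) * (Y t ord0 i * w (Y t)))).
  by apply: intbleZl; exact: ikyw.
have i2 : intble (fun t => - (p x ord0 i * h ord0 i) * (k x (Y t) * w (Y t))).
  by apply: intbleZl; exact: ikw.
have igi : intble gi by exact: intbleD.
have Igi : \int[mu]_t gi t = 0.
  rewrite RintegralD// !RintegralZl//.
  rewrite -/(N x i) -/(G x) zproxE; field; exact: lt0r_neq0.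
rewrite (_ : (fun t => _) = fun t => gi t + \sum_(j <- r) (Y t - p x) ord0 j * h ord0 j * (k x (Y t) * w (Y t))).
  by split; [exact: intbleD|rewrite RintegralD// Igi Ir addr0].
by apply/funext => t; rewrite big_cons giE.
Qed.

(** Moving the centre by [h] multiplies the density by [expR e * expR (dotv (y - p x) h / s)]. The
    second factor is at least [1 + dotv (y - p x) h / s], whose linear part has mean zero, so
    [expR e * G x <= G (x + h)]; then take logarithms. *)
Lemma soft_env_smooth x h :
  lam * soft_env lam del f (x + h) <=
  lam * soft_env lam del f x + dotv (x - zprox lam del f x) h + dotv h h / 2.
Proof.
rewrite -/p; pose e := dotv (p x - x) h / s - dotv h h / (2 * s).
have sV : s != 0 by rewrite gt_eqF.
have kE y : k (x + h) y = expR e * expR (dotv (y - p x) h / s) * k x y.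
  rewrite /k !gauss_densE [RHS]mulrCA -!expRD; congr (c * expR _).
  rewrite /e; move: (p x) => a; rewrite !dotvE (dotvC y x) (dotvC y h) (dotvC h x); field.
  exact: lt0r_neq0.
have [im Im] := moment0 x h.
have im' : intble (fun t => s^-1 * (dotv (Y t - p x) h * (k x (Y t) * w (Y t)))).
  by apply: intbleZl.
have ikw' := ikw x.
have GE : expR e * G x <= G (x + h).
  have -> : expR e * G x = \int[mu]_t (expR e * (k x (Y t) * w (Y t) +
      s^-1 * (dotv (Y t - p x) h * (k x (Y t) * w (Y t))))).
    rewrite RintegralZl//; last exact: intbleD.
    by rewrite RintegralD// RintegralZl// Im mulr0 addr0.
  apply: le_Rintegral => //.
  - by apply: intbleZl; exact: intbleD.
  move=> t _; rewrite kE; move: (k x (Y t)) (k_ge0 x (Y t)) => kt kt0.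
  rewrite -!mulrA ler_wpM2l ?expR_ge0//.
  have -> : kt * w (Y t) + s^-1 * (dotv (Y t - p x) h * (kt * w (Y t))) =
    (1 + dotv (Y t - p x) h / s) * (kt * w (Y t)) by field.
  by rewrite ler_wpM2r ?expR_ge1Dx// mulr_ge0 ?expR_ge0.
move: (G x) (G (x + h)) GE (G_gt0 x) (G_gt0 (x + h)) (soft_envE x) (soft_envE (x + h)).
move=> u v uv u0 v0 -> ->.
have : e + ln u <= ln v.
  by rewrite -[e]expRK -lnM ?posrE ?expR_gt0// ler_ln ?posrE ?mulr_gt0 ?expR_gt0.
rewrite -(ler_pM2l s0) mulrDr.
have -> : s * e = dotv (p x - x) h - dotv h h / 2 by rewrite /e; field.
rewrite -[x - p x]opprB dotvNl; move: (dotv (p x - x) h) (dotv h h) (ln u) (ln v) => a b LG LG'.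
by rewrite /s; lra.
Qed.

Lemma soft_env_quadratic_bound q : exists B, forall z,
  lam * soft_env lam del f z - dotv (z - q) (z - q) / 2 <= B.
Proof.
have [K K0 hK] := gauss_lower_bound q; exists (- s * ln K) => z.
move: (hK z) (G_gt0 z) (soft_envE z); move: (G z) => u Ku u0 ->.
have : ln K - dotv (z - q) (z - q) / (2 * s) <= ln u.
  rewrite -mulNr -[X in _ + X]expRK -lnM ?posrE ?expR_gt0//.
  by rewrite ler_ln ?posrE ?mulr_gt0 ?expR_gt0.
rewrite -(ler_pM2l s0) mulrBr.
have -> : s * (dotv (z - q) (z - q) / (2 * s)) = dotv (z - q) (z - q) / 2.
  by field; rewrite gt_eqF.
by move: (ln u) (ln K) (dotv _ _) => a b D; rewrite /s; lra.
Qed.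

Let gauss_vanish (u : nat -> 'rV[R]_d) y : (forall n, n%:R < `|u n|) ->
  k (u n) y @[n --> \oo] --> 0.
Proof.
move=> u_large; rewrite /k; under eq_fun do rewrite gauss_densE mulNr.
suff D_oo : dotv (y - u n) (y - u n) / (2 * s) @[n --> \oo] --> +oo.
  have := cvgM (cvg_cst c) (cvg_comp _ _ D_oo (@cvgr_expR R)).
  by rewrite mulr0; apply.
(* The summand 1 forces [enorm (y - u n) >= 1], so the square dominates the norm and a threshold
   linear in [A] suffices. *)
apply/cvgryPge => A; exists (Num.truncn (`|y| + 1 + 2 * s * `|A|)).+1 => // n /= nN.
have Nn : `|y| + 1 + 2 * s * `|A| < n%:R.
  by apply: lt_le_trans (truncnS_gt _) _; rewrite ler_nat.
rewrite ler_pdivlMr ?mulr_gt0// -sqr_enorm.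
have A0 : A <= `|A| := ler_norm A.
have sA : 0 <= s * `|A| by rewrite mulr_ge0// ltW.
have sA' : s * A <= s * `|A| by rewrite ler_pM2l.
have : 1 + 2 * s * `|A| <= enorm (y - u n).
  rewrite (le_trans _ (norm_le_enorm _))// distrC (le_trans _ (lerB_dist _ _))//.
  have := u_large n; lra.
move=> h; have : enorm (y - u n) <= enorm (y - u n) ^+ 2.
  by rewrite expr2 ler_peMr ?enorm_ge0//; lra.
lra.
Qed.

(** Otherwise points [u n] escape to infinity with [G (u n)] at least [expR (- (M / del))], while
    dominated convergence with majorant [c * w] sends [G (u n)] to 0. *)
Lemma soft_env_coercive M :
  exists r, forall x, soft_env lam del f x <= M -> `|x| <= r.
Proof.
apply: contrapT => /forallNP noR.
have /choice[u hu] : forall n : nat, exists x, soft_env lam del f x <= M /\ n%:R < `|x|.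
  move=> n; apply: contrapT => /forallNP no; apply: (noR n%:R) => x xM.
  by rewrite leNgt; apply/negP => nx; exact: (no x).
pose m := expR (- (M / del)).
have mG n : (m%:E <= \int[mu]_t (k (u n) (Y t) * w (Y t))%:E)%E.
  rewrite -[leRHS]fineK; last exact: (integrable_fin_num measurableT (ikw (u n))).
  rewrite lee_fin -[fine _]/(G (u n)); have [+ _] := hu n; rewrite soft_envE.
  move: (G (u n)) (G_gt0 (u n)) => v v0 vM.
  rewrite -[v]lnK ?posrE// ler_expR lerNl ler_pdivlMr//; lra.
have kw0 : (\int[mu]_t (k (u n) (Y t) * w (Y t))%:E)%E @[n --> \oo] --> (\int[mu]_t 0%:E)%E.
  have [] // := @dominated_convergence _ T R mu setT measurableT
    (fun n t => (k (u n) (Y t) * w (Y t))%:E) (cst 0%E) (fun t => (c * w (Y t))%:E).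
  - by move=> n; apply/measurable_EFinP; exact: measurable_funM.
  - apply: aeW => t _; apply/cvg_EFin; first exact: nearW.
    rewrite -(mul0r (w (Y t))); apply: cvgM; last exact: cvg_cst.
    by apply: gauss_vanish => n; have [] := hu n.
  - exact: intbleZl.
  - apply: aeW => t n _; rewrite lee_fin ger0_norm ?mulr_ge0 ?expR_ge0//.
    by rewrite ler_wpM2r ?expR_ge0.
have : (m%:E <= \int[mu]_t 0%:E)%E by exact: cvge_ge (nearW _ mG) kw0.
by rewrite integral0 lee_fin leNgt expR_gt0.
Qed.

End Gaussian.

(** The singleton [prox_set] expresses existence and uniqueness of the proximal point, and the value
    at [xs] is the minimum. Differentiability is asserted with the gradient bound because [grad] is
    read off the differential ['d]. *)
Theorem theorem5 (R : realType) (d : nat) (lam del : R)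
  (f : 'rV[R]_d -> R) (x0 : 'rV[R]_d) :
  (0 < d)%N -> 0 < lam -> 0 < del ->
  (* (A1) *)
  continuous f -> (exists xm : 'rV[R]_d, forall y, f xm <= f y) ->
  (* (A2) *)
  (iint (fun y : 'rV[R]_d => (expR (- f y / del))%:E) < +oo)%E ->
  convex_fn (soft_env lam del f) ->
  (exists H : 'rV[R]_d -> R, convex_fn H /\
     forall x, prox_set (lam * del) H x = [set zprox lam del f x]) /\
  firmly_nonexpansive (zprox lam del f) /\
  exists xs : 'rV[R]_d,
    argmin_set (soft_env lam del f) xs /\
    (fun k : nat => iter k (zprox lam del f) x0) @ \oo --> xs /\
    forall k : nat, (0 < k)%N ->
      soft_env lam del f (iter k (zprox lam del f) x0) - soft_env lam del f xs
        <= (dist_set x0 (argmin_set (soft_env lam del f))) ^+ 2 / (2 * lam * k%:R) /\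
      differentiable (soft_env lam del f) (iter k (zprox lam del f) x0) /\
      enorm (grad (soft_env lam del f) (iter k (zprox lam del f) x0))
        <= 2 * dist_set x0 (argmin_set (soft_env lam del f)) / (lam * k.+1%:R).
Proof.
move=> _ lam0 del0 f_cont _ f_int F_cvx.
have [disp [T [mu [Y [mY iintE boxE]]]]] := iint_measure R d.
apply: (proximal_scheme lam0 F_cvx _ _ _ _ x0 (mulr_gt0 lam0 del0)).
- by move=> x h; exact: (soft_env_smooth mY iintE boxE lam0 del0 f_cont f_int).
- by move=> q; exact: (soft_env_quadratic_bound mY iintE boxE lam0 del0 f_cont f_int).
- by move=> M; exact: (soft_env_coercive mY iintE boxE lam0 del0 f_cont f_int).
Qed.
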